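(* Consider the geometric model of the Lorenz equations described in the context. There exist constants $C_g>0$ and $\lambda_g>0$ depending only on the parameters of the model such that, for Lebesgue almost every point $u\in\Lambda^{\mathrm{geo}}$, there exists a continuous curve $U(u)\subset\Lambda^{\mathrm{geo}}$ (called a leaf set) such that $\{\|v-u\|_\infty : v\in U(u)\}=[0,d_{\max}(u)]$ for some constant $d_{\max}(u)>0$, and for every $v\in U(u)$ and every $t>0$, $$\|v(t)-u(t)\|_\infty\le C_g\,\|v-u\|_\infty\,\exp(-\lambda_g t).$$ Moreover, one can choose $$U(u)=\left\{v\in\Lambda^{\mathrm{geo}}: v_1=u_1,\ v_3=u_3,\ |v_2-u_2|\le \tfrac13-\tfrac1{2^\beta}\right\}.$$
   Context: Geometric model. Parameters: $0<\lambda_3<\lambda_1<\lambda_2$ and $\theta$; put $\alpha=\lambda_3/\lambda_1$, $\beta=\lambda_2/\lambda_1$ and assume $\frac1{\sqrt2}<\alpha<1$, $\beta>\frac{\log 6}{\log 2}-1$, $\frac{2^\alpha}{\sqrt2\,\alpha}<\theta<2^\alpha$. Let $S=\{(u_1,u_2,1):|u_1|\le\frac12,|u_2|\le\frac12\}$ (the return square), $S^*=\{u\in S:u_1\ne0\}$, $\Gamma=\{u\in S:u_1=0\}$. Linear phase: a path started at $u\in S$ follows $\Psi^{\mathrm{lin}}_t(u)=(u_1e^{\lambda_1t},u_2e^{-\lambda_2t},u_3e^{-\lambda_3t})$ until it reaches $\Sigma=\{|u_1|=1\}$. For $u\in S^*$ this happens at time $\tau_\Sigma(u)=\frac1{\lambda_1}\log(1/|u_1|)$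 at the point $(\mathrm{sgn}(u_1),u_2|u_1|^\beta,|u_1|^\alpha)$; paths started on $\Gamma$ follow the linear flow forever and converge to the origin. Rotation phase: from the point $w=(\pm1,w_2,w_3)$ reached on $\Sigma$, with $r(s)=1-w_3+\left(\frac12-(\theta-1)w_3\right)\frac{s}{(3/2)\pi}$, the path for $0\le s\le\frac32\pi$ is $\Psi^{\mathrm{rot}}_s(w)=\left(1+r(s)\sin s,\ w_2-\frac14\frac{s}{(3/2)\pi},\ 1-r(s)\cos s\right)$ if $w_1=1$, and $\Psi^{\mathrm{rot}}_s(w)=\left(-1-r(s)\sin s,\ w_2+\frac14\frac{s}{(3/2)\pi},\ 1-r(s)\cos s\right)$ if $w_1=-1$. At $s=\frac32\pi$ the path is back in $S$ and the linear phase starts again. $\Lambda^{\mathrm{geo}}\subset\mathbb R^3$ is the union of all points on paths started in $S$ until their first return to $S$ (including the points on the non-returning paths started on $\Gamma$). $\Psi^{\mathrm{geo}}_t$, $t\ge0$, is the semigroup on $\Lambda^{\mathrm{geo}}$ obtained by concatenating the two phases, and $u(t):=\Psi^{\mathrm{geo}}_t(u)$. *)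

(* Defs.v *)
From HB Require Import structures.
From mathcomp Require Import all_boot all_order all_algebra.
From mathcomp Require Import all_classical all_reals all_analysis.

Set Implicit Arguments.
Unset Strict Implicit.
Unset Printing Implicit Defensive.
Import Order.TTheory GRing.Theory Num.Theory.
Import numFieldNormedType.Exports.

Local Open Scope classical_set_scope.
Local Open Scope ring_scope.

(* Points of R^3 are nested pairs ((u1, u2), u3). The library's norm on a
   product is the maximum of the norms of the components, so `|u| is the
   sup norm. *)
Notation point3 R := (R * R * R)%type.

Definition lebesgue3 (R : realType) :=
  ((@lebesgue_measure R \x @lebesgue_measure R) \x @lebesgue_measure R)%E.

Arguments lebesgue3 R : clear implicits.

Section GeometricLorenz.
Variable R : realType.
Implicit Types (u v w x : point3 R) (s t : R).

Record params := Params { lam1 : R; lam2 : R; lam3 : R; theta : R }.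

Definition alpha (p : params) : R := lam3 p / lam1 p.
Definition beta (p : params) : R := lam2 p / lam1 p.

Definition admissible (p : params) : Prop :=
  [/\ [/\ 0 < lam3 p, lam3 p < lam1 p & lam1 p < lam2 p],
      (Num.sqrt 2)^-1 < alpha p /\ alpha p < 1,
      ln 6 / ln 2 - 1 < beta p &
      2 `^ alpha p / (Num.sqrt 2 * alpha p) < theta p /\
      theta p < 2 `^ alpha p].

Definition square : set (point3 R) :=
  [set u | [/\ `|u.1.1| <= 2^-1, `|u.1.2| <= 2^-1 & u.2 = 1]].

Variable p : params.

Definition psi_lin t u : point3 R :=
  (u.1.1 * expR (lam1 p * t), u.1.2 * expR (- lam2 p * t),
   u.2 * expR (- lam3 p * t)).

Definition tau u : R := (lam1 p)^-1 * ln (`|u.1.1|^-1).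

Definition exit_point u : point3 R :=
  (Num.sg u.1.1, u.1.2 * `|u.1.1| `^ beta p, `|u.1.1| `^ alpha p).

Lemma psi_lin_tau u : 0 < lam1 p -> square u -> u.1.1 != 0 ->
  psi_lin (tau u) u = exit_point u.
Proof.
move=> l0 [_ _ u3] u0.
have n0 : 0 < `|u.1.1| by rewrite normr_gt0.
rewrite /psi_lin /exit_point /tau lnV ?posrE // u3 mul1r /powR.
rewrite normr_eq0 (negbTE u0) mulrA mulfV ?gt_eqF // mul1r expRN lnK ?posrE //.
congr (_, _ * expR _, expR _); rewrite /alpha /beta.
- by rewrite [X in X * _]numEsg mulfK ?gt_eqF.
- by rewrite mulrN mulrNN mulrA.
- by rewrite mulrN mulrNN mulrA.
Qed.

Definition rot_time : R := 3 / 2 * pi.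

Definition radius w s : R :=
  1 - w.2 + (2^-1 - (theta p - 1) * w.2) * (s / rot_time).

(* Only used for w.1.1 = 1 or w.1.1 = -1. *)
Definition psi_rot s w : point3 R :=
  if w.1.1 == 1 then
    (1 + radius w s * sin s, w.1.2 - 4^-1 * (s / rot_time),
     1 - radius w s * cos s)
  else
    (-1 - radius w s * sin s, w.1.2 + 4^-1 * (s / rot_time),
     1 - radius w s * cos s).

Definition return_time u : R := tau u + rot_time.

Definition return_map u : point3 R := psi_rot rot_time (exit_point u).

(* [path_dom x s]: the path started at x in the square has not yet passed its
   first return at time s; if x.1.1 = 0, it never returns. *)
Definition path_dom x s : Prop :=
  [/\ square x, 0 <= s & x.1.1 != 0 -> s <= return_time x].

Definition geo_path x s : point3 R :=
  if (x.1.1 == 0) || (s <= tau x) then psi_lin s x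
  else psi_rot (s - tau x) (exit_point x).

Definition Lambda_geo : set (point3 R) :=
  [set u | exists x s, path_dom x s /\ u = geo_path x s].

(* Concatenation of paths: n bounds the number of pieces that are used. *)
Fixpoint concat_paths (n : nat) x t : point3 R :=
  if n is n'.+1 then
    if (x.1.1 == 0) || (t <= return_time x) then geo_path x t
    else concat_paths n' (return_map x) (t - return_time x)
  else x.

(* Every return takes at least time 3 pi / 2 > 1, so at most t returns occur up
   to time t and (truncn t).+1 pieces are enough. *)
Definition flow_from_square x t : point3 R :=
  concat_paths (Num.truncn t).+1 x t.

(* A point u of Lambda_geo is reached at time s on the path from some x in the
   square, and then flows on along the orbit of x. The pair (x, s) is unique,
   except that a return point u = return_map x is also the pair (u, 0), which
   gives the same forward orbit. *)
Definition psi_geo t u : point3 R :=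
  let xs := get [set xs : point3 R * R |
                 path_dom xs.1 xs.2 /\ u = geo_path xs.1 xs.2] in
  flow_from_square xs.1 (xs.2 + t).

Definition continuous_curve (U : set (point3 R)) : Prop :=
  exists gamma : R -> point3 R,
    {within `[0, 1], continuous gamma} /\ U = gamma @` `[0, 1]%classic.

Definition leaf_set (C lam : R) u (U : set (point3 R)) : Prop :=
  [/\ continuous_curve U,
      U `<=` Lambda_geo,
      exists dmax : R, 0 < dmax /\ [set `|v - u| | v in U] = `[0, dmax]%classic &
      forall v t, U v -> 0 < t ->
        `|psi_geo t v - psi_geo t u| <= C * `|v - u| * expR (- lam * t)].

Definition standard_leaf u : set (point3 R) :=
  [set v | [/\ Lambda_geo v, v.1.1 = u.1.1, v.2 = u.2 &
               `|v.1.2 - u.1.2| <= 3^-1 - (2 `^ beta p)^-1]].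

End GeometricLorenz.

(* Main.v *)
Require Import Defs.
From mathcomp Require Import all_boot all_order all_algebra.
From mathcomp Require Import all_classical all_reals all_analysis.
From mathcomp Require Import ring lra.
Import Order.TTheory GRing.Theory Num.Theory.
Import numFieldNormedType.Exports.
Local Open Scope classical_set_scope.
Local Open Scope ring_scope.

(** The second coordinate never influences the first and the third one, nor
    the time of the next return.  Two paths that start in the square at points
    with the same first coordinate therefore stay vertically above each other
    for ever, in the sense that they only differ in the second coordinate.
    The difference is multiplied by exp (- lam2 * t) during a linear phase of
    duration t and is constant during a rotation ([geo_path_aligned]).
    Every linear phase that reaches the exit section lasts at least
    ln 2 / lam1, because the square has half-width 1 / 2, whereas a rotation
    lasts 3 pi / 2.  The contraction of the linear phases, averaged over full
    returns, thus has a positive exponential rate ([decay_rate_return]), and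
    induction on the number of returns gives the estimate for whole orbits
    ([flow_contract]).  A point of the attractor may be observed in the middle
    of a rotation, where no contraction takes place until the next return: this
    is what the constant exp (decay_rate * 3 pi / 2) pays for.

    What remains is to see that two points of the attractor that lie vertically
    above each other at distance at most 1 / 3 - 1 / 2 ^ beta do come from such
    a pair of paths, at the same time ([vertical_inj]).  In the linear phase
    the third coordinate is a clock.  In the rotation phase (radius, angle) are
    polar coordinates in the plane of the first and third coordinates, and the
    radius at a given angle determines the exit height, hence the start of the
    path up to its side.  The two lobes overlap in this plane only where both
    angles are larger than pi; there the rotations have shifted the second
    coordinate by more than 1 / 6 in opposite directions, while the strips that
    enter the rotations have half-width at most 1 / 2 ^ beta / 2, so the lobes
    are more than 1 / 3 - 1 / 2 ^ beta apart.
    Beyond the exit section, a point of the rotation phase lies above or beside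
    all points of the linear phase unless it has height 1; the plane of the
    square is a null set and is discarded.

    Consequently the points of the attractor above and below a given one within
    that distance form a nondegenerate segment ([standard_leaf_segment]). *)

(** * Exit section and rotation *)

Section Rotation.
Set Implicit Arguments.
Unset Strict Implicit.
Context {R : realType} {p : params R} (hp : admissible p).

Lemma lam1_gt0 : 0 < lam1 p.
Proof. by case: hp => -[l3 l31 _] _ _ _; exact: lt_trans l31. Qed.

Lemma lam2_gt0 : 0 < lam2 p.
Proof. by case: hp => -[_ _ l12] _ _ _; exact: lt_trans lam1_gt0 l12. Qed.

Lemma alpha_gt0 : 0 < alpha p.
Proof. by case: hp => -[l3 _ _] _ _ _; rewrite divr_gt0// lam1_gt0. Qed.

Lemma beta_gt0 : 0 < beta p.
Proof. by rewrite divr_gt0 ?lam1_gt0 ?lam2_gt0. Qed.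

Lemma theta_gt0 : 0 < theta p.
Proof.
case: hp => _ _ _ [th _]; apply: lt_trans th.
by rewrite divr_gt0 ?powR_gt0// mulr_gt0 ?alpha_gt0 ?sqrtr_gt0.
Qed.

(** The bound on beta says exactly that 3 < 2 ^ beta. *)
Lemma leaf_radius_gt0 : 0 < 3^-1 - (2 `^ beta p)^-1.
Proof.
case: hp => _ _ hbeta _.
have ln2_gt0 : 0 < ln 2 :> R by rewrite ln_gt0// ltr1n.
rewrite subr_gt0 ltf_pV2 ?posrE ?powR_gt0//.
rewrite -ltr_ln ?posrE ?powR_gt0// ln_powR.
have : ln 6 = ln 2 + ln 3 :> R.
  by rewrite -lnM ?posrE// -natrM.
by move: hbeta; rewrite ltrBlDr ltr_pdivrMr// mulrDl mul1r => ? ?; lra.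
Qed.

Lemma rot_time_gt0 : 0 < rot_time R.
Proof. by rewrite /rot_time !mulr_gt0// ?invr_gt0// pi_gt0. Qed.

Lemma rot_time_ge1 : 1 <= rot_time R.
Proof. by rewrite /rot_time; have := @pi_ge2 R; lra. Qed.

(** The two rotations are mirror images of each other, so the sign of the
    first coordinate lets both be treated by one formula. *)
Lemma psi_rot_exitE (x : point3 R) s : x.1.1 != 0 ->
  psi_rot p s (exit_point p x) =
  (Num.sg x.1.1 * (1 + Defs.radius p (exit_point p x) s * sin s),
   x.1.2 * `|x.1.1| `^ beta p - Num.sg x.1.1 * (4^-1 * (s / rot_time R)),
   1 - Defs.radius p (exit_point p x) s * cos s).
Proof.
move=> x0; rewrite /psi_rot /=.
case: (ltrgt0P x.1.1) (x0) => [x1 _|x1 _|//].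
  by rewrite gtr0_sg// eqxx !mul1r.
rewrite ltr0_sg//; have -> : (-1 == 1 :> R) = false by apply/eqP; lra.
by congr (_, _, _); ring.
Qed.

Lemma exit_height_gt0 (x : point3 R) : x.1.1 != 0 -> 0 < `|x.1.1| `^ alpha p.
Proof. by move=> x0; rewrite powR_gt0// normr_gt0. Qed.

Lemma exit_powR_le (x : point3 R) (a : R) : 0 < a -> `|x.1.1| <= 2^-1 ->
  `|x.1.1| `^ a <= (2 `^ a)^-1.
Proof.
move=> a0 xle; rewrite -powRN powRN -powR_inv1 ?powR_ge0// -powRrM mulrC powRrM.
rewrite powR_inv1//.
by apply: ge0_ler_powR; rewrite ?nnegrE ?normr_ge0 ?invr_ge0// ltW.
Qed.

(** Both bounds come from |x_1| <= 1 / 2, the second one through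
    theta < 2 ^ alpha: it keeps the returning path inside the square. *)
Lemma exit_height_lt1 (x : point3 R) : `|x.1.1| <= 2^-1 ->
  `|x.1.1| `^ alpha p < 1 /\ theta p * `|x.1.1| `^ alpha p < 1.
Proof.
move=> xle; have wle := @exit_powR_le x _ alpha_gt0 xle.
have P0 : 0 < 2 `^ alpha p :> R by rewrite powR_gt0.
split.
  apply: le_lt_trans wle _; rewrite invf_lt1//.
  by rewrite -ltr_ln ?posrE// ln1 ln_powR mulr_gt0 ?alpha_gt0// ln_gt0// ltr1n.
apply: (le_lt_trans (y := theta p * (2 `^ alpha p)^-1)).
  by rewrite ler_wpM2l// ltW ?theta_gt0.
by rewrite ltr_pdivrMr// mul1r; case: hp => _ _ _ [].
Qed.

Lemma radius_itv (x : point3 R) s : x.1.1 != 0 -> `|x.1.1| <= 2^-1 ->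
  0 <= s <= rot_time R -> 0 < Defs.radius p (exit_point p x) s <= 3 / 2.
Proof.
move=> x0 xle /andP[s0 srot]; rewrite /Defs.radius /=.
have [w1 tw1] := exit_height_lt1 xle.
have w0 := exit_height_gt0 x0.
have q0 : 0 <= s / rot_time R by rewrite divr_ge0// ltW ?rot_time_gt0.
have q1 : s / rot_time R <= 1 by rewrite ler_pdivrMr ?mul1r// rot_time_gt0.
move: (s / rot_time R) q0 q1 => q q0 q1.
move: w0 w1 tw1 (theta_gt0); set w := `|_| `^ _; set th := theta p.
move=> w0 w1 tw1 th0.
(* linear interpolation between the initial and the final radius *)
have -> : 1 - w + (2^-1 - (th - 1) * w) * q =
          (1 - w) * (1 - q) + (3 / 2 - th * w) * q by field.
have tw0 : 0 < th * w by rewrite mulr_gt0.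
move: (th * w) tw0 tw1 => t t0 t1; apply/andP; split; last by nra.
have [->|qn] := eqVneq q 0; first by lra.
have {qn} : 0 < q by rewrite lt_neqAle eq_sym qn.
by nra.
Qed.

Lemma cos_eq1_small (d : R) : 0 <= d -> d < 2 * pi -> cos d = 1 -> d = 0.
Proof.
move=> d0 d2 cd; apply/eqP; rewrite eq_le d0 andbT leNgt; apply/negP => dp.
have : 0 < sin (d / 2) by apply: sin_gt0_pi; apply/andP; split; lra.
have := cos2Dsin2 (d / 2); have := cosD (d / 2) (d / 2).
rewrite -splitr cd => e1 e2 s0.
have : sin (d / 2) * sin (d / 2) = 0 by lra.
by move/eqP; rewrite mulf_eq0 orbb gt_eqF.
Qed.

(** The angles of a rotation fill three quarters of a circle, so no two of
    them agree modulo 2 pi. *)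
Lemma polar_angle_inj (s s' : R) : 0 <= s <= rot_time R ->
  0 <= s' <= rot_time R -> cos s = cos s' -> sin s = sin s' -> s = s'.
Proof.
move=> /andP[s0 s1] /andP[t0 t1] ec es.
wlog le_ts : s s' s0 s1 t0 t1 ec es / s' <= s.
  by move=> W; case: (leP s' s) => [|/ltW] st; [|apply/esym]; exact: W.
apply/eqP; rewrite -subr_eq0; apply/eqP/cos_eq1_small; first lra.
  by move: s1; rewrite /rot_time; have := @pi_gt0 R; lra.
by rewrite cosB -ec -es; have := cos2Dsin2 s; lra.
Qed.

Lemma polar_inj (r r' s s' : R) : 0 < r -> 0 < r' -> 0 <= s <= rot_time R ->
  0 <= s' <= rot_time R -> r * cos s = r' * cos s' -> r * sin s = r' * sin s' ->
  r = r' /\ s = s'.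
Proof.
move=> r0 r'0 sI s'I ec es.
have err : r = r'.
  apply/eqP; rewrite -(@eqrXn2 _ 2%N) ?ltW//; apply/eqP.
  have -> : r ^+ 2 = (r * cos s) ^+ 2 + (r * sin s) ^+ 2.
    by rewrite !exprMn -mulrDr cos2Dsin2 mulr1.
  by rewrite ec es !exprMn -mulrDr cos2Dsin2 mulr1.
split=> //; subst r'; apply: polar_angle_inj => //;
  by apply: (mulfI (lt0r_neq0 r0)).
Qed.

End Rotation.

(** * Contraction of vertical distances *)

Section Contraction.
Set Implicit Arguments.
Unset Strict Implicit.

Definition aligned (R : realType) (x y : point3 R) : Prop :=
  x.1.1 = y.1.1 /\ x.2 = y.2.

Definition linear_time (R : realType) (p : params R) (x : point3 R)
    (s : R) : R :=
  if (x.1.1 == 0) || (s <= tau p x) then s else tau p x.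

Definition leaf_contraction (R : realType) (p : params R) (x : point3 R) (s : R)
  : R := expR (- lam2 p * linear_time p x s).

(** The duration of the linear phase of the paths from |x_1| = 1 / 2, the
    shortest possible one. *)
Definition linear_time_min (R : realType) (p : params R) : R := ln 2 / lam1 p.

(** The rate lam2 of the linear phase, diluted by the share of time that a
    return with the shortest linear phase spends there. *)
Definition decay_rate (R : realType) (p : params R) : R :=
  lam2 p * linear_time_min p / (linear_time_min p + rot_time R).

Context {R : realType} {p : params R} (hp : admissible p).
Implicit Types (x y : point3 R) (s t : R).

Lemma norm_aligned x y : aligned x y -> `|y - x| = `|y.1.2 - x.1.2|.
Proof.
case: x y => [[x1 x2] x3] [[y1 y2] y3] [/= -> ->].
by rewrite prod_normE /= prod_normE /= !subrr normr0 (@max_r _ _ 0)// max_l.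
Qed.

Lemma exit_contraction x : x.1.1 != 0 ->
  `|x.1.1| `^ beta p = expR (- lam2 p * tau p x).
Proof.
move=> x0; have n0 : 0 < `|x.1.1| by rewrite normr_gt0.
rewrite /powR gt_eqF// /beta /tau lnV ?posrE//; congr expR.
by have := lam1_gt0 hp => l1; field; rewrite gt_eqF.
Qed.

(** Both phases are affine in the second coordinate of the start, and exit
    time, first and third coordinates do not depend on it. *)
Lemma geo_path_aligned x y s : aligned x y ->
  geo_path p y s =
  ((geo_path p x s).1.1,
   (geo_path p x s).1.2 + leaf_contraction p x s * (y.1.2 - x.1.2),
   (geo_path p x s).2).
Proof.
case: x y => [[a b] c] [[_ b'] _] [/= <- <-].
rewrite /geo_path /leaf_contraction /linear_time /=.
have -> : tau p (a, b', c) = tau p (a, b, c) by [].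
have [/= _|/= /norP[a0 _]] := boolP (_ || _).
  by rewrite /psi_lin /=; congr (_, _, _); ring.
rewrite !psi_rot_exitE//= (@exit_contraction (a, b', c))//=.
have -> : tau p (a, b', c) = tau p (a, b, c) by [].
by congr (_, _, _); ring.
Qed.

Lemma geo_path_aligned_dist x y s : aligned x y ->
  aligned (geo_path p x s) (geo_path p y s) /\
  `|geo_path p y s - geo_path p x s| = leaf_contraction p x s * `|y - x|.
Proof.
move=> xy; have al : aligned (geo_path p x s) (geo_path p y s).
  by rewrite (geo_path_aligned _ xy).
split=> //; rewrite (norm_aligned al) (norm_aligned xy).
rewrite (geo_path_aligned _ xy) /=.
by rewrite addrAC subrr add0r normrM [X in X * _]gtr0_norm// expR_gt0.
Qed.

Lemma return_mapE x : x.1.1 != 0 ->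
  return_map p x = geo_path p x (return_time p x).
Proof.
move=> x0; rewrite /geo_path (negPf x0) /= /return_time gerDl.
by rewrite leNgt rot_time_gt0 /= addrAC subrr add0r.
Qed.

Lemma linear_time_min_gt0 : 0 < linear_time_min p.
Proof. by rewrite divr_gt0 ?(lam1_gt0 hp)// ln_gt0// ltr1n. Qed.

Lemma tau_ge_min x : x.1.1 != 0 -> `|x.1.1| <= 2^-1 ->
  linear_time_min p <= tau p x.
Proof.
move=> x0 xle; rewrite /linear_time_min /tau mulrC.
rewrite ler_pM2l ?invr_gt0 ?(lam1_gt0 hp)//.
rewrite ler_ln ?posrE ?invr_gt0 ?normr_gt0//.
by rewrite -[2]invrK lef_pV2 ?posrE ?invr_gt0 ?normr_gt0.
Qed.

Lemma return_time_ge1 x : x.1.1 != 0 -> `|x.1.1| <= 2^-1 ->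
  1 <= return_time p x.
Proof.
move=> x0 xle; have := tau_ge_min x0 xle; have := linear_time_min_gt0.
by rewrite /return_time; have := rot_time_ge1 (R := R); lra.
Qed.

Lemma return_time_aligned x y : aligned x y ->
  return_time p y = return_time p x.
Proof. by move=> [yx _]; rewrite /return_time /tau yx. Qed.

Lemma sin_rot_time : sin (rot_time R) = -1.
Proof.
have -> : rot_time R = pi / 2 + pi by rewrite /rot_time; field.
by rewrite sinDpi sin_pihalf.
Qed.

Lemma cos_rot_time : cos (rot_time R) = 0.
Proof.
have -> : rot_time R = pi / 2 + pi by rewrite /rot_time; field.
by rewrite cosDpi cos_pihalf oppr0.
Qed.

Lemma return_map_half x : x.1.1 != 0 -> `|x.1.1| <= 2^-1 ->
  `|(return_map p x).1.1| <= 2^-1.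
Proof.
move=> x0 xle; rewrite /return_map psi_rot_exitE//= sin_rot_time.
rewrite normrM normr_sg x0 mul1r /Defs.radius /= divff ?gt_eqF ?rot_time_gt0//.
have [w1 tw1] := exit_height_lt1 hp xle.
have tw0 : 0 < theta p * `|x.1.1| `^ alpha p.
  by rewrite mulr_gt0 ?theta_gt0 ?exit_height_gt0.
by rewrite ler_norml; apply/andP; split; lra.
Qed.

Lemma decay_rate_gt0 : 0 < decay_rate p.
Proof.
have m0 := linear_time_min_gt0; have r0 := rot_time_gt0 (R := R).
apply: divr_gt0; last exact: addr_gt0.
by apply: mulr_gt0 => //; exact: lam2_gt0 hp.
Qed.

Lemma decay_rate_le : decay_rate p <= lam2 p.
Proof.
have m0 := linear_time_min_gt0; have r0 := rot_time_gt0 (R := R).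
rewrite ler_pdivrMr ?addr_gt0//.
rewrite ler_pM2l ?(lam2_gt0 hp)//.
by rewrite lerDl ltW.
Qed.

(** A full return contracts at least at the averaged rate: a linear phase
    that is longer than the shortest one only increases its share. *)
Lemma decay_rate_return x : x.1.1 != 0 -> `|x.1.1| <= 2^-1 ->
  decay_rate p * return_time p x <= lam2 p * tau p x.
Proof.
move=> x0 xle; have := tau_ge_min x0 xle; rewrite /return_time /decay_rate.
have m0 := linear_time_min_gt0; have r0 := rot_time_gt0 (R := R).
have l2 := lam2_gt0 hp.
move: (linear_time_min p) (tau p x) (rot_time R) m0 r0 => m t r m0 r0 mt.
rewrite mulrAC ler_pdivrMr ?addr_gt0// -!mulrA ler_pM2l//.
by nra.
Qed.

(** No constant is needed for paths observed from the square on, because the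
    contracting phase of a return comes before the neutral one. *)
Lemma leaf_contraction_le x s : `|x.1.1| <= 2^-1 -> 0 <= s ->
  (x.1.1 != 0 -> s <= return_time p x) ->
  leaf_contraction p x s <= expR (- decay_rate p * s).
Proof.
move=> xle s0 sret; rewrite ler_expR !mulNr lerN2 /linear_time.
have [_|/norP[x0 _]] := boolP (_ || _).
  by rewrite ler_wpM2r// decay_rate_le.
apply: le_trans (decay_rate_return x0 xle).
by rewrite ler_pM2l ?decay_rate_gt0// sret.
Qed.

(** The bound t < n makes n pieces suffice, so that the concatenation is
    never cut off before time t. *)
Lemma concat_paths_contract n x y t : aligned x y -> `|x.1.1| <= 2^-1 ->
  0 <= t < n%:R ->
  `|concat_paths p n y t - concat_paths p n x t|
    <= expR (- decay_rate p * t) * `|y - x|.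
Proof.
elim: n => [|n IH] in x y t * => xy xle /andP[t0 tn].
  by move: (le_lt_trans t0 tn); rewrite ltxx.
have eqret := return_time_aligned xy.
rewrite /=; have [yx _] := xy; rewrite -yx eqret.
have [short|/norP[x0]] := boolP (_ || _).
  have [_ ->] := geo_path_aligned_dist t xy.
  rewrite ler_wpM2r// leaf_contraction_le// => x0.
  by move: short; rewrite (negPf x0).
rewrite -ltNge => late.
have y0 : y.1.1 != 0 by rewrite -yx.
have [al dist] := geo_path_aligned_dist (return_time p x) xy.
have ret1 := return_time_ge1 x0 xle.
(* every return takes time at least 1, so one piece pays for it *)
have := IH (return_map p x) (return_map p y) (t - return_time p x).
rewrite !return_mapE// eqret dist => {}IH.
apply: le_trans (IH _ _ _) _ => //.
- by rewrite -return_mapE//; exact: return_map_half.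
- by rewrite -natr1 in tn; apply/andP; split; lra.
rewrite mulrA ler_wpM2r//.
apply: (le_trans (y := expR (- decay_rate p * (t - return_time p x)) *
                       expR (- decay_rate p * return_time p x))).
  rewrite ler_wpM2l ?expR_ge0// leaf_contraction_le//.
  by lra.
by rewrite -expRD -mulrDr subrK.
Qed.

(** Between time s and the next return, a duration of at most one rotation
    may pass without the contraction that the rate calls for. *)
Lemma flow_contract x y s t : aligned x y -> `|x.1.1| <= 2^-1 -> 0 <= s ->
  (x.1.1 != 0 -> s <= return_time p x) -> 0 < t ->
  `|flow_from_square p y (s + t) - flow_from_square p x (s + t)|
    <= expR (decay_rate p * rot_time R) * `|geo_path p y s - geo_path p x s| *
       expR (- decay_rate p * t).
Proof.
move=> xy xle s0 sret t0.
have [_ ->] := geo_path_aligned_dist s xy.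
have st0 : 0 <= s + t by lra.
rewrite /flow_from_square.
have r0 := rot_time_gt0 (R := R); have dr0 := decay_rate_gt0.
have l2 := lam2_gt0 hp; have dl := decay_rate_le.
have eqret := return_time_aligned xy.
have [short|/norP[x0]] := boolP ((x.1.1 == 0) || (s + t <= return_time p x)).
  rewrite /=; have [yx _] := xy; rewrite -yx eqret short.
  have [_ ->] := geo_path_aligned_dist (s + t) xy.
  rewrite mulrA mulrAC ler_wpM2r//.
  rewrite /leaf_contraction -!expRD ler_expR /linear_time.
  have [x0|x0] /= := eqVneq x.1.1 0; first by nra.
  move: short (sret x0); rewrite (negPf x0) /= /return_time => short sret'.
  by case: (leP (s + t) (tau p x)) => ?; case: (leP s (tau p x)) => ?; nra.
rewrite -ltNge => late.
have nt : s + t < ((Num.truncn (s + t)).+1)%:R := truncnS_gt (s + t).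
have y0 : y.1.1 != 0 by case: xy => <-.
have [al dist] := geo_path_aligned_dist (return_time p x) xy.
have ret1 := return_time_ge1 x0 xle.
rewrite /= (negPf x0) (negPf y0) eqret (leNgt (s + t)) late /=.
rewrite !return_mapE// eqret.
apply: le_trans (concat_paths_contract al _ _) _.
- by rewrite -return_mapE//; exact: return_map_half.
- by rewrite -natr1 in nt; apply/andP; split; lra.
rewrite dist mulrA [leRHS]mulrAC [leRHS]mulrA ler_wpM2r//.
rewrite /leaf_contraction -!expRD ler_expR /linear_time (negPf x0) /=.
rewrite ifF; last by rewrite /return_time gerDl leNgt r0.
move: (sret x0) late; rewrite /return_time => sret' late.
by case: (leP s (tau p x)) => ?; nra.
Qed.

End Contraction.

(** * Points of the attractor on a common vertical line *)

Section Leaves.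
Set Implicit Arguments.
Unset Strict Implicit.
Context {R : realType} {p : params R} (hp : admissible p).
Implicit Types (x y u v : point3 R) (s t : R).

Lemma lin_phase_bounds x s : path_dom p x s ->
  (x.1.1 == 0) || (s <= tau p x) ->
  `|(geo_path p x s).1.1| <= 1 /\ (geo_path p x s).2 <= 1.
Proof.
move=> [sx s0 _] lin; rewrite /geo_path lin /=; case: (sx) => _ _ ->; split.
  have [->|x0] := eqVneq x.1.1 0; first by rewrite mul0r normr0.
  have l1 := lam1_gt0 hp; rewrite normrM (gtr0_norm (expR_gt0 _)).
  move: lin; rewrite (negPf x0) /= => stau.
  apply: (le_trans (y := `|x.1.1| * expR (lam1 p * tau p x))).
    by rewrite ler_wpM2l// ler_expR ler_pM2l.
  have /(congr1 (fun w => `|w.1.1|)) := psi_lin_tau l1 sx x0.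
  by rewrite /= normrM normr_sg x0 (gtr0_norm (expR_gt0 _)) => ->.
rewrite mul1r -expR0 ler_expR mulNr oppr_le0 mulr_ge0// ltW//.
by case: hp => -[].
Qed.

Lemma rot_phaseP x s : path_dom p x s ->
  ~~ ((x.1.1 == 0) || (s <= tau p x)) ->
  [/\ x.1.1 != 0, `|x.1.1| <= 2^-1, `|x.1.2| <= 2^-1,
      0 <= s - tau p x <= rot_time R & 0 < s - tau p x].
Proof.
move=> [[x1 x2 _] s0 sret] /norP[x0]; rewrite -ltNge => taus.
move: (sret x0); rewrite /return_time => sret'.
by split=> //; [apply/andP; split|]; lra.
Qed.

Lemma cos_le0_late (a : R) : pi <= a <= rot_time R -> cos a <= 0.
Proof.
move=> /andP[a0 a1]; rewrite -[a](subrK pi) cosDpi oppr_le0.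
apply: cos_ge0_pihalf; move: a1; rewrite /rot_time.
by have := @pi_gt0 R => pi0 a1; apply/andP; split; lra.
Qed.

(** Up to the angle pi the rotation takes place beyond the exit section, and
    afterwards not below the plane of the square. *)
Lemma rot_phase_outside x s : path_dom p x s ->
  ~~ ((x.1.1 == 0) || (s <= tau p x)) -> (geo_path p x s).2 != 1 ->
  1 < `|(geo_path p x s).1.1| \/ 1 < (geo_path p x s).2.
Proof.
move=> xs rot; have [x0 x1 x2 aI a0] := rot_phaseP xs rot.
rewrite /geo_path (negPf rot) psi_rot_exitE//=.
have /andP[r0 r1] := radius_itv hp x0 x1 aI.
move: aI a0; set a := s - _; set r := Defs.radius _ _ _ in r0 r1 * => aI a0 n1.
have [a_pi|pi_a] := ltP a pi; [left|right].
  have sa : 0 < sin a by apply: sin_gt0_pi; rewrite a0.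
  have ra := mulr_gt0 r0 sa.
  by rewrite normrM normr_sg x0 mul1r gtr0_norm; lra.
have ca : cos a <= 0.
  by apply: cos_le0_late; case/andP: aI => _ ->; rewrite pi_a.
by rewrite lt_neqAle eq_sym n1 /=; nra.
Qed.

Lemma exit_second_le x : `|x.1.1| <= 2^-1 -> `|x.1.2| <= 2^-1 ->
  `|x.1.2 * `|x.1.1| `^ beta p| <= 2^-1 * (2 `^ beta p)^-1.
Proof.
move=> x1 x2; rewrite normrM; apply: ler_pM => //.
by rewrite ger0_norm ?powR_ge0// exit_powR_le// beta_gt0.
Qed.

(** Suppose that the paths turn on opposite sides.  At an angle up to pi a path
    is at distance at least 1 from the plane u_1 = 0, whereas the other one,
    with radius at most 3 / 2, never reaches farther than 1 / 2 across that
    plane.  Hence both angles exceed pi, and the lobes are too far apart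
    vertically. *)
Lemma same_lobe x y s t : path_dom p x s -> path_dom p y t ->
  ~~ ((x.1.1 == 0) || (s <= tau p x)) -> ~~ ((y.1.1 == 0) || (t <= tau p y)) ->
  (geo_path p y t).1.1 = (geo_path p x s).1.1 ->
  `|(geo_path p y t).1.2 - (geo_path p x s).1.2| <= 3^-1 - (2 `^ beta p)^-1 ->
  Num.sg x.1.1 = Num.sg y.1.1.
Proof.
move=> xs yt rx ry.
have [x0 x1 x2 aI a0] := rot_phaseP xs rx.
have [y0 y1 y2 bI b0] := rot_phaseP yt ry.
rewrite /geo_path (negPf rx) (negPf ry) !psi_rot_exitE//=.
have := exit_second_le x1 x2; have := exit_second_le y1 y2.
have := radius_itv hp x0 x1 aI; have := radius_itv hp y0 y1 bI.
set a := s - _ in aI a0 *; set b := t - _ in bI b0 *.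
move: (Defs.radius _ _ a) (Defs.radius _ _ b) => r r'.
move: (x.1.2 * _) (y.1.2 * _) => w w' /andP[r'0 r'1] /andP[r0 r1].
rewrite !ler_norml => /andP[w'1 w'2] /andP[w1 w2] e1 /andP[d1 d2].
have sa1 := sin_le1 a; have saN := sin_geN1 a.
have sb1 := sin_le1 b; have sbN := sin_geN1 b.
have pi0 := @pi_gt0 R.
have [/andP[a00 a_r] /andP[b00 b_r]] := (aI, bI).
(* signs are nonzero, so different signs are opposite *)
suff : Num.sg x.1.1 != - Num.sg y.1.1.
  by case: (ltrgt0P x.1.1) x0 => // hx _; case: (ltrgt0P y.1.1) y0 => // hy _;
     rewrite ?(gtr0_sg hx) ?(ltr0_sg hx) ?(gtr0_sg hy) ?(ltr0_sg hy) ?opprK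
             ?eqxx.
apply/eqP => sg.
move: e1 d1 d2; rewrite sg.
have e2 : Num.sg y.1.1 = 1 \/ Num.sg y.1.1 = -1.
  case: (ltrgt0P y.1.1) y0 => // hy _.
  - by left; exact: gtr0_sg.
  - by right; exact: ltr0_sg.
move=> e1 d1 d2.
have opp : 1 + r' * sin b = - (1 + r * sin a) by case: e2 e1 => ->; lra.
have a_pi : pi < a.
  rewrite ltNge; apply/negP => api.
  have : 0 <= sin a by apply: sin_ge0_pi; rewrite api a00.
  by nra.
have b_pi : pi < b.
  rewrite ltNge; apply/negP => bpi.
  have : 0 <= sin b by apply: sin_ge0_pi; rewrite bpi b00.
  by nra.
have qa : 2 / 3 < a / rot_time R.
  by rewrite ltr_pdivlMr ?rot_time_gt0// /rot_time; lra.
have qb : 2 / 3 < b / rot_time R.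
  by rewrite ltr_pdivlMr ?rot_time_gt0// /rot_time; lra.
move: (a / _) (b / _) qa qb d1 d2 => qa qb ha hb d1 d2.
by case: e2 d1 d2 => ->; lra.
Qed.

(** Third coordinate 1 is excluded because the plane of the square contains
    both the starting points and the end points of the rotations. *)
Lemma vertical_inj x y s t : path_dom p x s -> path_dom p y t ->
  (geo_path p x s).2 != 1 ->
  (geo_path p y t).1.1 = (geo_path p x s).1.1 ->
  (geo_path p y t).2 = (geo_path p x s).2 ->
  `|(geo_path p y t).1.2 - (geo_path p x s).1.2| <= 3^-1 - (2 `^ beta p)^-1 ->
  aligned x y /\ s = t.
Proof.
move=> xs yt n1 e1 e3 d2.
have n1' : (geo_path p y t).2 != 1 by rewrite e3.
have x3 : x.2 = 1 by case: xs => -[].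
have y3 : y.2 = 1 by case: yt => -[].
rewrite /aligned x3 y3.
have [lx|rx] := boolP ((x.1.1 == 0) || (s <= tau p x)); last first.
  have outx := rot_phase_outside xs rx n1.
  have [ly|ry] := boolP ((y.1.1 == 0) || (t <= tau p y)).
    have [iy1 iy3] := lin_phase_bounds yt ly.
    by case: outx; rewrite -?e1 -?e3; lra.
  have sg := same_lobe xs yt rx ry e1 d2.
  have [x0 x1 x2 aI a0] := rot_phaseP xs rx.
  have [y0 y1 y2 bI b0] := rot_phaseP yt ry.
  have /andP[r0 _] := radius_itv hp x0 x1 aI.
  have /andP[r'0 _] := radius_itv hp y0 y1 bI.
  move: e1 e3; rewrite /geo_path (negPf rx) (negPf ry) !psi_rot_exitE//= sg.
  have sgn0 : Num.sg y.1.1 != 0 by rewrite sgr_eq0.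
  move=> /(mulfI sgn0)/addrI es /addrI/oppr_inj ec.
  have [er ea] := polar_inj r'0 r0 bI aI ec es.
  (* at a given angle the radius is strictly decreasing in the exit height *)
  have ew : `|y.1.1| `^ alpha p = `|x.1.1| `^ alpha p.
    move: er; rewrite ea /Defs.radius /=.
    have q0 : 0 <= (s - tau p x) / rot_time R.
      by rewrite divr_ge0// ltW// rot_time_gt0.
    have q1 : (s - tau p x) / rot_time R <= 1.
      by rewrite ler_pdivrMr ?rot_time_gt0// mul1r; case/andP: aI.
    move: (_ / rot_time R) q0 q1 (theta_gt0 hp) => q q0 q1 th0.
    move: (_ `^ _) (_ `^ _) => w w' e.
    have c0 : 0 < 1 + (theta p - 1) * q.
      have [->|qn] := eqVneq q 0; first by lra.
      have : 0 < q by rewrite lt_neqAle eq_sym qn.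
      by nra.
    apply/eqP; rewrite -subr_eq0; apply/eqP/(mulfI (lt0r_neq0 c0)).
    by rewrite mulr0; lra.
  have en := powR_injective (alpha_gt0 hp) (normr_ge0 _) (normr_ge0 _) ew.
  have exy : x.1.1 = y.1.1 by rewrite (numEsg x.1.1) (numEsg y.1.1) sg en.
  split=> //; move: ea; rewrite /tau en; lra.
have [ly|ry] := boolP ((y.1.1 == 0) || (t <= tau p y)); last first.
  have outy := rot_phase_outside yt ry n1'.
  by have [iy1 iy3] := lin_phase_bounds xs lx; case: outy; rewrite ?e1 ?e3; lra.
move: e1 e3; rewrite /geo_path lx ly /= x3 y3 !mul1r => e1 /expR_inj.
have l3 : - lam3 p != 0 by rewrite oppr_eq0 gt_eqF//; case: hp => -[].
move=> /(mulfI l3) st; split=> //; split=> //.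
by move: e1; rewrite st => /(mulIf (lt0r_neq0 (expR_gt0 _))) ->.
Qed.

(** * Leaves as segments *)

Lemma continuous_curve_segment (a b c d : R) : a <= b ->
  continuous_curve
    [set v : point3 R | [/\ v.1.1 = c, v.2 = d & a <= v.1.2 <= b]].
Proof.
move=> ab; exists (fun t : R => (c, a + t * (b - a), d)); split.
  apply: continuous_subspaceT => t.
  apply: (@cvg_pair _ _ _ _ (nbhs (c, a + t * (b - a))) (nbhs d)).
    apply: (@cvg_pair _ _ _ _ (nbhs c) (nbhs (a + t * (b - a)))).
      exact: cvg_cst.
    apply: cvgD; first exact: cvg_cst.
    by apply: cvgM; [exact: cvg_id|exact: cvg_cst].
  exact: cvg_cst.
apply/seteqP; split => [[[v1 v2] v3] /= [-> -> /andP[h1 h2]]|v /= [t]].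
  have [ba|ba] := eqVneq b a.
    exists 0; first by rewrite /= in_itv /= lexx ler01.
    by rewrite mul0r addr0; congr (_, _, _); lra.
  have ba0 : 0 < b - a by rewrite subr_gt0 lt_neqAle eq_sym ba.
  exists ((v2 - a) / (b - a)).
    by rewrite /= in_itv /= divr_ge0 ?ler_pdivrMr//; lra.
  by rewrite divfK ?gt_eqF//; congr (_, _, _); lra.
rewrite /= in_itv /= => /andP[t0 t1] <- /=; split => //.
by apply/andP; split; nra.
Qed.

Lemma segment_dist_range u (a b : R) : a <= u.1.2 <= b ->
  [set `|v - u| | v in
    [set v : point3 R | [/\ v.1.1 = u.1.1, v.2 = u.2 & a <= v.1.2 <= b]]] =
  `[0, Num.max (u.1.2 - a) (b - u.1.2)]%classic.
Proof.
move=> /andP[au ub].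
apply/seteqP; split => [d /= [v [e1 e3 /andP[av vb]] <-]|d].
  rewrite in_itv /= norm_aligned; last by split.
  by rewrite normr_ge0 /= le_max; case: (lerP u.1.2 v.1.2) => ?;
     apply/orP; [right|left]; lra.
rewrite /= in_itv /= le_max => /andP[d0 /orP[] dle].
  exists (u.1.1, u.1.2 - d, u.2); first by split=> //=; apply/andP; split; lra.
  by rewrite norm_aligned//= addrAC subrr add0r normrN ger0_norm.
exists (u.1.1, u.1.2 + d, u.2); first by split=> //=; apply/andP; split; lra.
by rewrite norm_aligned//= addrAC subrr add0r ger0_norm.
Qed.

Lemma truncated_interval (w c l r : R) : 0 < c -> l <= w <= r -> l < r ->
  Num.max (w - c) l <= w <= Num.min (w + c) r /\
  Num.max (w - c) l < Num.min (w + c) r.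
Proof.
move=> c0 /andP[lw wr] lr; rewrite ge_max le_min gt_max !lt_min.
by rewrite lw wr lr !andbT; repeat (apply/andP; split) || split; lra.
Qed.

(** By [vertical_inj] the vertical line through a point meets the attractor,
    within the given distance, exactly in the points reached at the same time
    by the paths from the vertical segment through the start of its path; the
    second coordinates of these starts range over [-1 / 2, 1 / 2]. *)
Lemma standard_leaf_segment u : Lambda_geo p u -> u.2 != 1 ->
  exists a b, [/\ a <= u.1.2 <= b, a < b &
    standard_leaf p u =
      [set v : point3 R | [/\ v.1.1 = u.1.1, v.2 = u.2 & a <= v.1.2 <= b]]].
Proof.
move=> [x [s [xs ->]]]; set u0 := geo_path p x s => n1.
set m := leaf_contraction p x s.
have m0 : 0 < m by exact: expR_gt0.
have c0 := leaf_radius_gt0 hp; set c := 3^-1 - _ in c0.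
have [[x1 + x3] s0 sret] := xs; rewrite ler_norml => /andP[x2l x2r].
exists (Num.max (u0.1.2 - c) (u0.1.2 + m * (- 2^-1 - x.1.2))).
exists (Num.min (u0.1.2 + c) (u0.1.2 + m * (2^-1 - x.1.2))).
have ml : m * (- 2^-1 - x.1.2) <= 0 by rewrite mulr_ge0_le0 ?(ltW m0)//; lra.
have mr : 0 <= m * (2^-1 - x.1.2) by rewrite mulr_ge0 ?(ltW m0)//; lra.
have lr : u0.1.2 + m * (- 2^-1 - x.1.2) < u0.1.2 + m * (2^-1 - x.1.2).
  by rewrite ltrD2l ltr_pM2l//; lra.
have wI : u0.1.2 + m * (- 2^-1 - x.1.2) <= u0.1.2
                <= u0.1.2 + m * (2^-1 - x.1.2).
  by rewrite gerDl lerDl ml mr.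
have [ends nondeg] := truncated_interval c0 wI lr; split=> //.
apply/seteqP; split => [v [[y [t [yt ->]]] e1 e3 d2]|v /= [e1 e3]].
  have [xy st] := vertical_inj xs yt n1 e1 e3 d2.
  split=> //; rewrite ge_max le_min.
  have [[_ + _] _ _] := yt; rewrite ler_norml => /andP[y2l y2r].
  move: d2; rewrite -/c ler_norml => /andP[dl dr].
  rewrite -st (geo_path_aligned hp s xy) /= -/u0 -/m in dl dr *.
  have hl : 0 <= m * (y.1.2 + 2^-1) by rewrite mulr_ge0 ?(ltW m0)//; lra.
  have hr : 0 <= m * (2^-1 - y.1.2) by rewrite mulr_ge0 ?(ltW m0)//; lra.
  by apply/andP; split; apply/andP; split; lra.
rewrite ge_max le_min => /andP[/andP[dl ml'] /andP[dr mr']].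
have vle : `|v.1.2 - u0.1.2| <= c by rewrite ler_norml; apply/andP; split; lra.
split=> //.
(* the start from which the path reaches v at time s *)
pose y : point3 R := (x.1.1, x.1.2 + (v.1.2 - u0.1.2) / m, x.2).
have xy : aligned x y by [].
exists y, s; split.
  split=> //; split=> //=; rewrite ler_norml; apply/andP; split.
    by rewrite -lerBlDl ler_pdivlMr//; lra.
  by rewrite -lerBrDl ler_pdivrMr//; lra.
rewrite (geo_path_aligned hp s xy) -/u0 -/m /= addrAC subrr add0r.
rewrite mulrC divfK ?gt_eqF// subrKC -e1 -e3.
by case: (v) => [[]].
Qed.

(** The flow picks some starting point and time for each of u and v; by
    [vertical_inj] any two such choices are aligned, at the same time. *)
Lemma psi_geo_contract u v t : Lambda_geo p u -> u.2 != 1 ->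
  standard_leaf p u v -> 0 < t ->
  `|psi_geo p t v - psi_geo p t u| <=
    expR (decay_rate p * rot_time R) * `|v - u| * expR (- decay_rate p * t).
Proof.
move=> Lu n1 [Lv e1 e3 d2] t0; rewrite /psi_geo.
have repr w : Lambda_geo p w -> exists xs : point3 R * R,
    path_dom p xs.1 xs.2 /\ w = geo_path p xs.1 xs.2.
  by move=> [x [s h]]; exists (x, s).
have := getPex (repr _ Lu); have := getPex (repr _ Lv).
move: (get _) (get _) => [y r] [x s] /= [ydom vy] [xdom ux]; subst u v.
have [xy <-] := vertical_inj xdom ydom n1 e1 e3 d2.
have [[x1 _ _] s0 sret] := xdom.
exact: flow_contract.
Qed.

Lemma standard_leaf_leaf_set u : Lambda_geo p u -> u.2 != 1 ->
  leaf_set p (expR (decay_rate p * rot_time R)) (decay_rate p) u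
    (standard_leaf p u).
Proof.
move=> Lu n1; have [a [b [uab ab E]]] := standard_leaf_segment Lu n1.
split.
- by rewrite E; apply: continuous_curve_segment; exact: ltW.
- by move=> v [].
- exists (Num.max (u.1.2 - a) (b - u.1.2)); split.
    rewrite lt_max; apply/orP; have [?|?] := ltP a u.1.2; [left|right]; lra.
  by rewrite E; exact: segment_dist_range.
- by move=> v t Uv t0; exact: psi_geo_contract.
Qed.

Lemma ae_off_horizontal_plane (c : R) (P : point3 R -> Prop) :
  (forall u, u.2 != c -> P u) -> {ae lebesgue3 R, forall u, P u}.
Proof.
move=> Pu; exists (setT `*` [set c]); split.
- by apply: measurableX.
- rewrite /lebesgue3 product_measure1E//.
  apply: etrans (mule0 _); congr (_ * _)%E; exact: lebesgue_measure_set1.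
- move=> u /= nPu; split=> //; apply/eqP/negP => /negP /Pu.
  exact: nPu.
Qed.

End Leaves.

Theorem theorem2p1 (R : realType) (p : params R) (hp : admissible p) :
  exists Cg lamg : R,
    [/\ 0 < Cg, 0 < lamg,
        {ae lebesgue3 R, forall u : point3 R, Lambda_geo p u ->
           exists U : set (point3 R), leaf_set p Cg lamg u U} &
        {ae lebesgue3 R, forall u : point3 R, Lambda_geo p u ->
           leaf_set p Cg lamg u (standard_leaf p u)}].
Proof.
exists (expR (decay_rate p * rot_time R)), (decay_rate p); split.
- exact: expR_gt0.
- exact: decay_rate_gt0.
- apply: (ae_off_horizontal_plane (c := 1)) => u n1 Lu.
  by exists (standard_leaf p u); exact: standard_leaf_leaf_set.
- apply: (ae_off_horizontal_plane (c := 1)) => u n1 Lu.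
  exact: standard_leaf_leaf_set.
Qed.
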